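(* Let $n\ge1$ be an integer and $\kappa\in\mathbb{C}\setminus\mathbb{Z}$. For all $\alpha,\beta\in\mathbb{C}$, the twisted trigonometric Shibukawa-Ueno operators $\mathcal{R}^t_{\alpha,\beta}(\lambda)$, $\lambda\in\mathbb{C}\setminus\mathbb{Z}$, restrict to $V^t_n\otimes V^t_n$, where $V^t_n=\mathrm{Span}_{\mathbb{C}}\{\phi_k(z)\mid k=0,\dots,n-1\}$ and $\phi_k(z)=e^{2\pi i(k-\frac{n-1}{2})z}$, yielding a finite dimensional representation which is homogeneous with respect to the basis $\{\phi_k\}$. These representations are precisely the two-parameter twisted affinized Cremmer-Gervais operators: with $q=e^{\pi i\kappa}$, $p=e^{\pi i\kappa/n}$ and $\phi_k$ identified with $e_k$, for each $(\alpha,\beta)$ the restriction of $\mathcal{R}^t_{\alpha,\beta}(\lambda)$ to $V^t_n\otimes V^t_n$ is, up to multiplication by a nonzero scalar function of $\lambda$, equal to $R_{CG(\alpha',\beta')}(\lambda)$ for some $(\alpha',\beta')\in\mathbb{C}^2$, and every $R_{CG(\alpha',\beta')}(\lambda)$ with $(\alpha',\beta')\in\mathbb{C}^2$ arises in this way.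
   Context: Let $\theta(z)=\sin\pi z$ and $G(z,\lambda)=\dfrac{\theta'(0)\theta(z+\lambda)}{\theta(z)\theta(\lambda)}$. The twisted trigonometric Shibukawa-Ueno operator acts on meromorphic functions $f$ on $\mathbb{C}^2$ by $$\mathcal{R}^t_{\alpha,\beta}(\lambda)\cdot f(z_1,z_2)=G(z_1-z_2-2(\alpha\lambda+\beta),\lambda)\,f(z_2+2\alpha\lambda,z_1-2\alpha\lambda)-G(z_1-z_2-2(\alpha\lambda+\beta),\kappa)\,f(z_1-2\beta,z_2+2\beta).$$ $V^t_n\otimes V^t_n$ is identified with the span of the functions $\phi_a(z_1)\phi_b(z_2)$. An operator $R(\lambda)$ on $V\otimes V$, where $V$ has basis $\{e_i\}$, is homogeneous if $R(\lambda)(e_i\otimes e_j)$ is a linear combination of the vectors $e_k\otimes e_{i+j-k}$ for all $i,j$. Matrix coefficients: $R(e_i\otimes e_j)=\sum_{k,l}R_{ij}^{kl}e_k\otimes e_l$, with indices in $\{0,\dots,n-1\}$. Write $\hat{x}=x-x^{-1}$ and $\widehat{q\eta^{-1}}=q\eta^{-1}-q^{-1}\eta$. With $p^n=q$ and $\eta=e^{\pi i\lambda}$, the affinized Cremmer-Gervais $R$-matrix is $$R_{CG}(\lambda)_{ij}^{kl}=p^{2(j-k)}\begin{cases}\widehat{q\eta^{-1}} & i=j=k=l,\\ -\hat\eta\,q^{\mathrm{sgn}(i-j)} & i=k\ne l=j,\\ \mathrm{sgn}(j-i)\,\hat\eta\,\hat q & \min(i,j)<k<\max(i,j),\ i+j=k+l,\\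 \hat q\,\eta^{\mathrm{sgn}(j-i)} & j=k\ne l=i,\\ 0&\text{otherwise.}\end{cases}$$ With $B(\mu)e_k=e^{2\pi i\mu k}e_k$ and $F_{\alpha,\beta}(\lambda)=B(\alpha\lambda-\beta)\otimes B(\alpha\lambda-\beta)^{-1}$, the two-parameter family is $R_{CG(\alpha,\beta)}(\lambda)=F_{\alpha,\beta}(-\lambda)R_{CG}(\lambda)F_{\alpha,\beta}(\lambda)$, i.e. $R_{CG(\alpha,\beta)}(\lambda)_{ij}^{kl}=\zeta^{2(i-k)}\gamma^{2(j-k)}R_{CG}(\lambda)_{ij}^{kl}$ with $\zeta=e^{2\pi i\alpha\lambda}$, $\gamma=e^{2\pi i\beta}$. *)

(* Defs.v *)
From HB Require Import structures.
From mathcomp Require Import all_boot all_order all_algebra.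
From mathcomp Require Import complex.
From mathcomp Require Import boolp classical_sets functions reals topology.
From mathcomp Require Import normedtype sequences derive exp trigo.

Set Implicit Arguments.
Unset Strict Implicit.
Unset Printing Implicit Defensive.

Import Order.TTheory GRing.Theory Num.Theory numFieldNormedType.Exports.

Local Open Scope ring_scope.
Local Open Scope complex_scope.

Section Trigonometric.
Variable R : realType.
Local Notation C := R[i].

Definition cexp (z : C) : C :=
  (expR (complex.Re z))%:C * (cos (complex.Im z) +i* sin (complex.Im z)).

Definition cpi : C := (pi : R)%:C.

Definition csin (z : C) : C := (cexp ('i * z) - cexp (- ('i * z))) / (2 * 'i).

Definition theta (z : C) : C := csin (cpi * z).

Definition is_integer (z : C) : Prop := exists m : int, z = m%:~R.

(* The derivative below is the complex one: C acts on itself as a normed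
   module over the field C. *)
Definition G (z lambda : C) : C :=
  derive1 (theta : C -> C^o) 0 * theta (z + lambda) / (theta z * theta lambda).

End Trigonometric.

Section Operators.
Variable R : realType.
Local Notation C := R[i].

(* A meromorphic function on C^2 is represented by a total function, whose
   values on the polar set are irrelevant. *)
Definition SU (kappa alpha beta lambda : C) (f : C -> C -> C) (z1 z2 : C) : C :=
  G (z1 - z2 - 2 * (alpha * lambda + beta)) lambda
    * f (z2 + 2 * alpha * lambda) (z1 - 2 * alpha * lambda)
  - G (z1 - z2 - 2 * (alpha * lambda + beta)) kappa
    * f (z1 - 2 * beta) (z2 + 2 * beta).

(* Equality of meromorphic functions whose poles lie on the divisor
   theta (z1 - z2 - 2 (alpha lambda + beta)) = 0, the only polar divisor of
   SU kappa alpha beta lambda f when f is entire (and lambda, kappa are not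
   integers).  Its complement is open and dense in C^2, so that pointwise
   agreement there is equality of meromorphic functions. *)
Definition mero_eq (alpha beta lambda : C) (f g : C -> C -> C) : Prop :=
  forall z1 z2 : C,
    theta (z1 - z2 - 2 * (alpha * lambda + beta)) != 0 -> f z1 z2 = g z1 z2.

Definition phi (n k : nat) (z : C) : C :=
  cexp (2 * cpi R * 'i * (k%:R - (n%:R - 1) / 2) * z).

(* V^t_n (x) V^t_n: the matrix v has the coordinates of a tensor in the basis
   e_i (x) e_j, and tensor_fun v is the function it is identified with. *)
Definition tensor_fun (n : nat) (v : 'M[C]_n) (z1 z2 : C) : C :=
  \sum_(i < n) \sum_(j < n) v i j * (phi n i z1 * phi n j z2).

(* X i j k l is the matrix coefficient X_{ij}^{kl}. *)
Definition coefs (n : nat) := 'I_n -> 'I_n -> 'I_n -> 'I_n -> C.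

Definition coefs_act (n : nat) (X : coefs n) (v : 'M[C]_n) : 'M[C]_n :=
  \matrix_(k, l) \sum_(i < n) \sum_(j < n) v i j * X i j k l.

Definition homogeneous (n : nat) (X : coefs n) : Prop :=
  forall i j k l : 'I_n, (i + j)%N <> (k + l)%N -> X i j k l = 0.

Definition is_restriction (n : nat) (kappa alpha beta lambda : C)
    (X : coefs n) : Prop :=
  forall v : 'M[C]_n,
    mero_eq alpha beta lambda
      (SU kappa alpha beta lambda (tensor_fun v)) (tensor_fun (coefs_act X v)).

Definition hat (x : C) : C := x - x^-1.

Definition sgn (i j : nat) : int := sgz (i%:Z - j%:Z).

Definition RCG (n : nat) (p q lambda : C) : coefs n := fun i j k l =>
  let eta := cexp (cpi R * 'i * lambda) in
  p ^ (2 * (j%:Z - k%:Z)) *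
  (if [&& i == j, j == k & k == l] then hat (q * eta^-1)
   else if [&& i == k, k != l & l == j] then - hat eta * q ^ sgn i j
   else if (minn i j < k < maxn i j)%N && (i + j == k + l)%N
     then (sgn j i)%:~R * hat eta * hat q
   else if [&& j == k, k != l & l == i] then hat q * eta ^ sgn j i
   else 0).

(* B(mu) and F_{alpha,beta}(lambda) are diagonal; these are the eigenvalues on
   e_k and e_i (x) e_j. *)
Definition Beig (mu : C) (k : nat) : C := cexp (2 * cpi R * 'i * mu * k%:R).

Definition Feig (alpha beta lambda : C) (i j : nat) : C :=
  Beig (alpha * lambda - beta) i * (Beig (alpha * lambda - beta) j)^-1.

Definition RCGab (n : nat) (p q alpha beta lambda : C) : coefs n :=
  fun i j k l =>
  Feig alpha beta (- lambda) k l * RCG p q lambda i j k l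
    * Feig alpha beta lambda i j.

(* The restriction of SU kappa alpha beta lambda is
   c lambda *: R_{CG(alpha',beta')}(lambda), with c independent of the matrix
   coefficients and without zeros on C \ Z. *)
Definition restriction_is_RCG (n : nat) (kappa alpha beta alpha' beta' : C) :
    Prop :=
  let q := cexp (cpi R * 'i * kappa) in
  let p := cexp (cpi R * 'i * kappa / n%:R) in
  exists c : C -> C, forall lambda : C, ~ is_integer lambda ->
    c lambda != 0 /\
    is_restriction kappa alpha beta lambda
      (fun i j k l : 'I_n =>
         c lambda * RCGab p q alpha' beta' lambda i j k l).

End Operators.

(* Main.v *)
Require Import Defs.
From mathcomp Require Import all_boot all_order all_algebra complex reals.
From mathcomp Require Import boolp classical_sets functions topology.
From mathcomp Require Import normedtype sequences derive exp trigo.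
From mathcomp Require Import ring lra zify.

(* Put x = e^(2 pi i z_1) / (zeta gamma)^2 and y = e^(2 pi i z_2).  On
   phi_i (x) phi_j the operator becomes, up to the scalar
   theta'(0) 2i / (\hat eta \hat q) and a diagonal twist, division by x - y of
     \hat q (x eta - y / eta) x^j y^i - \hat eta (x q - y / q) x^i y^j,
   and a telescoping geometric sum shows that the quotient is the polynomial
   whose coefficients are those of R_CG without the powers of p.  These powers
   only rescale gamma, so that alpha' = alpha and beta' = beta - kappa / (2 n).
   A restriction is unique because the x^k y^l stay linearly independent away
   from the poles, as seen on shifts of z_1 and z_2 by imaginary numbers. *)

Set Implicit Arguments.
Unset Strict Implicit.
Unset Printing Implicit Defensive.

Import Order.TTheory GRing.Theory Num.Theory numFieldNormedType.Exports.

Local Open Scope ring_scope.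
Local Open Scope complex_scope.

(** * The complex exponential, theta and its derivative at 0 *)

Lemma is_derive0_near (R : realType) (f : R -> R) (l e : R) :
  is_derive (0 : R) (1 : R) f l -> 0 < e ->
  exists2 d, 0 < d & forall x, `|x| < d -> `|f x - f 0 - l * x| <= e * `|x|.
Proof.
move=> [df fl] e0.
have : (h^-1 *: ((f \o shift 0) (h *: 1) - f 0) @[h --> 0^'] --> l)%classic.
  by rewrite -fl; exact: df.
move/cvgrPdist_le => /(_ _ e0) [d /= d0 H]; exists d => // x xd.
have [->|x0] := eqVneq x 0; first by rewrite mulr0 subrr subr0 normr0 mulr0.
have := H x; rewrite /= sub0r normrN => /(_ xd x0).
rewrite /shift /= addr0 [x *: 1]mulr1 => H1.
have -> : f x - f 0 - l * x = - (x * (l - x^-1 *: (f x - f 0))).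
  by rewrite /GRing.scale /= mulrBr mulrA divff // mul1r; ring.
by rewrite normrN normrM mulrC ler_wpM2r.
Qed.

Section cexp_theory.
Variable R : realType.
Local Notation C := R[i].

Lemma cexp0 : cexp (0 : C) = 1.
Proof. by rewrite /cexp /= expR0 cos0 sin0 mul1r. Qed.

Lemma cexpD (z w : C) : cexp (z + w) = cexp z * cexp w.
Proof.
case: z w => [a b] [c d]; rewrite /cexp /= expRD cosD sinD.
rewrite rmorphM mulrACA; congr (_ * _).
by apply/eqP; rewrite eq_complex /= eqxx /= addrC.
Qed.

Lemma cexp_neq0 (z : C) : cexp z != 0.
Proof.
apply/eqP => z0; have := cexpD z (- z).
by rewrite z0 mul0r subrr cexp0 => /eqP; rewrite oner_eq0.
Qed.

Lemma cexpN (z : C) : cexp (- z) = (cexp z)^-1.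
Proof.
by apply: (mulfI (cexp_neq0 z)); rewrite -cexpD subrr cexp0 divff ?cexp_neq0.
Qed.

Lemma cexpMn (z : C) (n : nat) : cexp (z * n%:R) = cexp z ^+ n.
Proof.
elim: n => [|n IH]; first by rewrite mulr0 cexp0.
by rewrite -natr1 mulrDr mulr1 cexpD IH exprSr.
Qed.

Lemma norm_real (x : R) : `|x%:C : C| = `|x|%:C.
Proof. by rewrite normc_def /= expr0n /= addr0 sqrtr_sqr. Qed.

Lemma norm_i : `|'i%C : C| = 1.
Proof. by rewrite normc_def /= expr0n /= add0r expr1n sqrtr1. Qed.

Lemma normc_geIm (z : C) : `|complex.Im z|%:C <= `|z|.
Proof.
have := normc_ge_Re ('i%C * z); rewrite normrM norm_i mul1r.
by case: z => a b /=; rewrite mul0r mul1r sub0r normrN.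
Qed.

Lemma normc_leReIm (z : C) : `|z| <= (`|complex.Re z| + `|complex.Im z|)%:C.
Proof.
rewrite {1}[z]complexE rmorphD /=; apply: (le_trans (ler_normD _ _)).
by rewrite normrM norm_i mul1r !norm_real.
Qed.

(** Complex differentiability at 0 is assembled from the real derivatives of [expR], [cos] and [sin]
    there, by splitting the error into its real part [A] and imaginary part [B]. *)
Lemma cexp_near0 (e : R) : 0 < e -> exists2 d : R, 0 < d &
  forall z : C, `|z| < d%:C -> `|cexp z - 1 - z| <= e%:C * `|z|.
Proof.
(* The bounds below are [4 * u * r] for [A] and [5 * u * r] for [B], whence the 9. With r < u <= 1
   one also has [|expR x - 1| <= 2 * r] and [|expR x| <= 3]. *)
move=> e0; have [u [u0 u1 ue]] : exists u, [/\ 0 < u, u <= 1 & 9 * u <= e].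
  exists (Num.min 1 (e / 9)); split; rewrite ?lt_min ?ge_min ?lexx //; first lra.
  have : Num.min 1 (e / 9) <= e / 9 by rewrite ge_min lexx orbT.
  lra.
have [d1 d10 H1] := is_derive0_near (is_derive_expR 0) u0.
have [d2 d20 H2] := is_derive0_near (is_derive_cos 0) u0.
have [d3 d30 H3] := is_derive0_near (is_derive_sin 0) u0.
exists (Num.min u (Num.min d1 (Num.min d2 d3))) => [|z].
  by rewrite !lt_min u0 d10 d20.
have Rez := normc_ge_Re z.
have Imz := normc_geIm z.
have : exists r, `|z| = r%:C by rewrite normc_def; eexists.
move=> [r zr]; rewrite {}zr in Rez Imz *; rewrite !lecR in Rez Imz.
rewrite ltcR !lt_min => /and4P[ru rd1 rd2 rd3].
case: z Rez Imz => [x y] /= xr yr.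
have {}H1 := H1 x (le_lt_trans xr rd1).
have {}H2 := H2 y (le_lt_trans yr rd2).
have {}H3 := H3 y (le_lt_trans yr rd3).
rewrite expR0 mul1r in H1; rewrite cos0 sin0 oppr0 mul0r subr0 in H2.
rewrite sin0 cos0 mul1r subr0 in H3.
have r0 : 0 <= r := le_trans (normr_ge0 _) xr.
set A := (expR x - 1 - x) + expR x * (cos y - 1).
set B := expR x * (sin y - y) + (expR x - 1) * y.
have -> : cexp (x +i* y) - 1 - (x +i* y) = A +i* B.
  apply/eqP; rewrite eq_complex /cexp /= /A /B; apply/andP; split; apply/eqP; ring.
apply: (le_trans (normc_leReIm _)) => /=; rewrite -rmorphM lecR.
have E1 : `|expR x - 1| <= 2 * r.
  have -> : expR x - 1 = (expR x - 1 - x) + x by ring.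
  apply: (le_trans (ler_normD _ _)); nra.
have E3 : `|expR x| <= 3.
  have -> : expR x = (expR x - 1) + 1 by ring.
  apply: (le_trans (ler_normD _ _)); rewrite normr1; nra.
have hA : `|A| <= 4 * u * r.
  apply: (le_trans (ler_normD _ _)); rewrite normrM.
  have : `|expR x| * `|cos y - 1| <= 3 * (u * r).
    by apply: ler_pM => //; apply: (le_trans H2); apply: ler_wpM2l => //; exact: ltW.
  nra.
have hB : `|B| <= 5 * u * r.
  apply: (le_trans (ler_normD _ _)); rewrite !normrM.
  have : `|expR x| * `|sin y - y| <= 3 * (u * r).
    by apply: ler_pM => //; apply: (le_trans H3); apply: ler_wpM2l => //; exact: ltW.
  have : `|expR x - 1| * `|y| <= (2 * r) * r by apply: ler_pM.
  nra.
nra.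
Qed.

(** Reduction modulo 2 pi leaves c in [0, 2 pi[ with cos c = 1. The double angle formula gives sin
    (c / 2) = 0, and sin is positive on ]0, pi[, so c = 0. *)
Lemma cos_eq1 (b : R) : cos b = 1 -> exists m : int, b = m%:~R * (2 * pi).
Proof.
move=> cb; have pi0 := pi_gt0 R.
have tpi0 : (0 : R) < 2 * pi by lra.
pose m := Num.floor (b / (2 * pi)); exists m.
have cosZ (k : int) a : cos (a + k%:~R * (2 * pi)) = cos a :> R.
  have cosn (k' : nat) a' : cos (a' + k'%:R * (2 * pi)) = cos a' :> R.
    elim: k' a' => [|k' IH] a'; first by rewrite mul0r addr0.
    have -> : a' + k'.+1%:R * (2 * pi) = a' + k'%:R * (2 * pi) + pi *+ 2.
      by rewrite -natr1; ring.
    by rewrite cosD2pi IH.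
  case: k => k; first exact: cosn.
  rewrite NegzE mulrNz mulNr.
  by have := cosn k.+1 (a - k.+1%:R * (2 * pi)); rewrite subrK => ->.
pose c := b - m%:~R * (2 * pi).
suff : c = 0 by move/eqP; rewrite subr_eq0 => /eqP.
have cc : cos c = 1 by rewrite -cb -(cosZ (- m) b) mulrNz mulNr.
have c0 : 0 <= c by rewrite subr_ge0 -ler_pdivlMr // floor_le.
have c2 : c < 2 * pi.
  have := floorD1_gt (b / (2 * pi)); rewrite ltr_pdivrMr // -/m intrD mulrDl mul1r.
  rewrite /c; lra.
have s0 : sin (c / 2) = 0.
  have := cos_mulr2n (c / 2); rewrite (_ : c / 2 *+ 2 = c); last by lra.
  rewrite cc cos2sin2.
  move=> H; apply/eqP; rewrite -sqrf_eq0; apply/eqP; lra.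
apply/eqP; rewrite eq_le c0 andbT leNgt; apply/negP => c_gt0.
have := @sin_gt0_pi R (c / 2); rewrite s0 ltxx => H; suff : false by [].
by apply: H; lra.
Qed.

(** For z = a + i b, the imaginary part forces sin b = 0, hence |cos b| = 1. The real part says cos
    b = e^(-a), so a = 0 and cos b = 1. *)
Lemma cexp_eq1 (z : C) : cexp z = 1 -> exists m : int, z = 2 * cpi R * 'i * m%:~R.
Proof.
case: z => a b /eqP; rewrite eq_complex /cexp /= !mul0r subr0 addr0.
move=> /andP[/eqP Hc /eqP Hs].
have s0 : sin b = 0 by apply: (mulfI (lt0r_neq0 (expR_gt0 a))); rewrite Hs mulr0.
have : `|cos b| = 1 by exact: sin0cos1.
have -> : cos b = expR (- a).
  by rewrite expRN -[LHS](mulKf (lt0r_neq0 (expR_gt0 a))) Hc mulr1.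
rewrite ger0_norm ?expR_ge0 // => Ha.
have a0 : a = 0.
  by apply/eqP; rewrite -oppr_eq0; apply/eqP/expR_inj; rewrite Ha expR0.
have [m ->] : exists m : int, b = m%:~R * (2 * pi).
  by apply: cos_eq1; rewrite -Hc a0 expR0 mul1r.
exists m; rewrite a0 [LHS]complexE /= add0r -complexiE /cpi.
rewrite !rmorphM /= rmorph_int rmorph_nat; ring.
Qed.

Lemma cpi2i_neq0 : cpi R * 'i != 0.
Proof. by rewrite mulf_neq0 ?neq0Ci // /cpi fmorph_eq0 lt0r_neq0 // pi_gt0. Qed.

Definition cexppi (z : C) : C := cexp (cpi R * 'i * z).

Lemma cexppi0 : cexppi 0 = 1.
Proof. by rewrite /cexppi mulr0 cexp0. Qed.

Lemma cexppiD z w : cexppi (z + w) = cexppi z * cexppi w.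
Proof. by rewrite /cexppi mulrDr cexpD. Qed.

Lemma cexppi_neq0 z : cexppi z != 0.
Proof. exact: cexp_neq0. Qed.

Lemma cexppiN z : cexppi (- z) = (cexppi z)^-1.
Proof. by rewrite /cexppi mulrN cexpN. Qed.

Lemma cexppiMn z k : cexppi (z * k%:R) = cexppi z ^+ k.
Proof. by rewrite /cexppi mulrA cexpMn. Qed.

Lemma thetaE (z : C) : theta z = hat (cexppi z) / (2 * 'i).
Proof.
rewrite /theta /csin /hat -cexppiN /cexppi; congr ((cexp _ - cexp _) / _); ring.
Qed.

(** A zero of [hat (cexppi z)] means e^(2 pi i z) = 1, which only integers satisfy. *)
Lemma hat_cexppi_neq0 (z : C) : ~ is_integer z -> hat (cexppi z) != 0.
Proof.
move=> zZ; apply/eqP => /eqP; rewrite subr_eq0 => /eqP zE; apply: zZ.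
have /cexp_eq1[m] : cexp (2 * cpi R * 'i * z) = 1.
  rewrite -[RHS](divff (cexppi_neq0 z)) -{}zE -cexpD; congr cexp; ring.
rewrite -!mulrA => /(mulfI _) zm; exists m.
apply: (mulfI cpi2i_neq0); rewrite -!mulrA; apply: zm.
by rewrite pnatr_eq0.
Qed.

Lemma theta_neq0 (z : C) : (theta z != 0) = (hat (cexppi z) != 0).
Proof.
by rewrite thetaE mulf_eq0 invr_eq0 mulf_eq0 pnatr_eq0 (negPf (neq0Ci _)) !orbF.
Qed.

Lemma derive1_theta0 : derive1 (@theta R : C -> C^o) 0 = cpi R.
Proof.
apply: cvg_lim; first exact: norm_hausdorff.
apply/cvgrPdist_le => eps; case: eps => e e'.
(* In the order of C a positive [eps] is real. *)
rewrite ltcE /= => /andP[/eqP -> e0].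
have pi0 := pi_gt0 R.
(* With u = pi i h, subtracting the estimates at u and -u bounds e^u - e^(-u) - 2u by 2 (e / pi) |u|
   = 2 e |h|. Division by 2 i h then leaves exactly e. *)
have [d d0 Hd] := cexp_near0 (divr_gt0 e0 pi0).
exists (d / pi)%:C => /=; first by rewrite ltcR divr_gt0.
move=> h /=; rewrite sub0r normrN => hd h0.
rewrite addr0 [theta 0]thetaE cexppi0 /hat invr1 subrr mul0r subr0.
have nu : `|cpi R * 'i * h| = pi%:C * `|h|.
  rewrite !normrM normCi mulr1; congr (_ * _); rewrite /cpi norm_real gtr0_norm //.
have ud : `|cpi R * 'i * h| < d%:C.
  by rewrite nu mulrC -ltr_pdivlMr ?ltcR // -fmorphV -rmorphM.
have H1 := Hd _ ud.
have := Hd (- (cpi R * 'i * h)); rewrite normrN => /(_ ud) H2.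
have {H1 H2} := le_trans (ler_normB _ _) (lerD H1 H2).
set X := (X in `|X|) => HX.
have -> : cpi R - h^-1 *: (theta h : C^o) = - (h^-1 * X / (2 * 'i)).
  rewrite thetaE /hat /cexppi -cexpN /X /GRing.scale /=.
  have i0 := neq0Ci C; field; rewrite i0 h0 //.
rewrite normrN !normrM !normrV ?unitfE ?mulf_neq0 ?pnatr_eq0 ?neq0Ci //.
rewrite normrM normCi mulr1 normr_nat ler_pdivrMr ?ltr0n //.
rewrite ler_pdivrMl ?normr_gt0 //.
apply: (le_trans HX); rewrite nu -[e +i* 0]/(e%:C).
have -> : (e / pi)%:C = e%:C / pi%:C :> C by rewrite rmorphM fmorphV.
have pC0 : (pi : R)%:C != 0 by rewrite fmorph_eq0 lt0r_neq0.
rewrite le_eqVlt; apply/orP; left; apply/eqP; rewrite mulrA divfK //; ring.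
Qed.

End cexp_theory.

(** * Algebraic identities for the Cremmer-Gervais coefficients *)

Lemma geometric_interval (F : comRingType) (x y : F) (a b : nat) : (a <= b)%N ->
  (x - y) * (\sum_(a <= k < b) x ^+ k * y ^+ (a + b - k.+1))
    = x ^+ b * y ^+ a - x ^+ a * y ^+ b.
Proof.
move=> ab; rewrite -(subnK ab); elim: (b - a)%N => [|d IH].
  by rewrite add0n big_geq // mulr0 subrr.
(* Raising the upper bound b = d + a by one multiplies the earlier terms by y and adds the term x^b
   y^a. *)
rewrite addSn big_nat_recr ?leq_addl //= mulrDr.
rewrite (_ : \sum_(a <= i < d + a) _ =
    y * (\sum_(a <= k < d + a) x ^+ k * y ^+ (a + (d + a) - k.+1))).
  rewrite mulrCA IH (_ : a + (d + a).+1 - (d + a).+1 = a)%N; last lia.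
  rewrite !exprS; ring.
rewrite big_distrr /=; apply: eq_big_nat => k /andP[ak kd].
rewrite (_ : a + (d + a).+1 - k.+1 = (a + (d + a) - k.+1).+1)%N ?exprS; last lia.
by rewrite mulrCA.
Qed.

Section CG.
Variables (F : fieldType) (n : nat) (q eta x y : F).
Hypotheses (q0 : q != 0) (eta0 : eta != 0).

Definition hatF (x : F) : F := x - x^-1.

(** The case table of [RCG] without its factor p^(2 (j - k)), over any field and with [eta] a free
    parameter, so that the identities below are purely algebraic. *)
Definition CG (i j k l : nat) : F := 
   (if [&& i == j, j == k & k == l] then hatF (q * eta^-1)
   else if [&& i == k, k != l & l == j] then - hatF eta * q ^ sgn i j
   else if (minn i j < k < maxn i j)%N && (i + j == k + l)%N
     then (sgn j i)%:~R * hatF eta * hatF q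
   else if [&& j == k, k != l & l == i] then hatF q * eta ^ sgn j i
   else 0).

Lemma sum_delta (i j : 'I_n) (c : F) (f : nat -> nat -> F) :
  \sum_(k < n) \sum_(l < n) 
    (if (k == i :> nat) && (l == j :> nat) then c else 0) * f k l = c * f i j.
Proof.
rewrite (bigD1 i) //= [X in _ + X]big1 ?addr0 => [|k /negPf ki]; last first.
  by apply: big1 => l _; rewrite val_eqE ki mul0r.
rewrite (bigD1 j) //= [X in _ + X]big1 ?addr0 ?eqxx // => l /negPf lj.
by rewrite val_eqE lj andbF mul0r.
Qed.

Lemma sum_middle (i j : 'I_n) (c : F) : 
  \sum_(k < n) \sum_(l < n)
    (if (minn i j < k < maxn i j)%N && (i + j == k + l)%N then c else 0) *
    (x ^+ k * y ^+ l)
  = c * \sum_((minn i j).+1 <= k < maxn i j) x ^+ k * y ^+ (i + j - k).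
Proof.
rewrite big_distrr (big_nat_widenl _ 0%N) //= (big_nat_widen _ _ n); last first.
  by have := ltn_ord i; have := ltn_ord j; lia.
rewrite big_mkord [RHS]big_mkcond /=; apply: eq_bigr => k _.
case: ifPn => mk; last first.
  apply: big1 => l _.
  by rewrite mul0r.
(* The only surviving l is i + j - k. As k exceeds the smaller of i and j, it lies below the larger
   one, hence below n. *)
have ln : (i + j - k < n)%N by have := ltn_ord i; have := ltn_ord j; lia.
rewrite (bigD1 (Ordinal ln)) //= [X in _ + X]big1 ?addr0.
  by rewrite (_ : i + j == _)%N //; lia.
move=> l; rewrite -val_eqE /= => lE.
by case: eqP => [|_]; rewrite ?mul0r //; lia.
Qed.

(** For i = j a single monomial occurs. Otherwise there are the two end terms x^i y^j and x^j y^i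
    and a geometric sum strictly between them. Multiplied by x - y, that sum collapses to two
    monomials, which combine with those of the end terms. *)
Lemma CG_sum (i j : 'I_n) :
  (x - y) * (\sum_(k < n) \sum_(l < n) CG i j k l * (x ^+ k * y ^+ l))
  = hatF q * (x * eta - y / eta) * (x ^+ j * y ^+ i)
    - hatF eta * (x * q - y / q) * (x ^+ i * y ^+ j).
Proof.
have [ij|ij] := eqVneq (i : nat) (j : nat).
  rewrite (_ : (\sum_(k < n) _) = hatF (q / eta) * (x ^+ i * y ^+ i)).
    rewrite -ij /hatF; field; exact/andP.
  rewrite -(sum_delta i i _ (fun k l => x ^+ k * y ^+ l)).
  apply: eq_bigr => k _; apply: eq_bigr => l _.
  congr (_ * _); rewrite /CG -ij.
  move: (nat_of_ord i) (nat_of_ord k) (nat_of_ord l) => a c d {k l}.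
  rewrite (_ : [&& a == a, a == c & c == d] = (c == a) && (d == a)); last lia.
  case: (boolP (_ && _)) => H //.
  rewrite (_ : [&& a == c, c != d & d == a] = false); last lia.
  by rewrite (_ : (minn a a < c < maxn a a)%N && _ = false) //; lia.
rewrite (_ : (\sum_(k < n) _) =
    \sum_(k < n) \sum_(l < n) (if (k == i :> nat) && (l == j :> nat)
      then - hatF eta * q ^ sgn i j else 0) * (x ^+ k * y ^+ l)
  + \sum_(k < n) \sum_(l < n) (if (k == j :> nat) && (l == i :> nat)
      then hatF q * eta ^ sgn j i else 0) * (x ^+ k * y ^+ l)
  + \sum_(k < n) \sum_(l < n) (if (minn i j < k < maxn i j)%N && (i + j == k + l)%N
      then (sgn j i)%:~R * hatF eta * hatF q else 0) * (x ^+ k * y ^+ l)); last first.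
  rewrite -!big_split /=; apply: eq_bigr => k _.
  rewrite -!big_split /=; apply: eq_bigr => l _.
  rewrite -!mulrDl; congr (_ * _); rewrite /CG.
  move: (nat_of_ord i) (nat_of_ord j) (nat_of_ord k) (nat_of_ord l) ij.
  move=> a b c d ab {k l}.
  rewrite (_ : [&& a == b, b == c & c == d] = false); last lia.
  rewrite (_ : [&& a == c, c != d & d == b] = (c == a) && (d == b)); last lia.
  rewrite (_ : [&& b == c, c != d & d == a] = (c == b) && (d == a)); last lia.
  case: (boolP ((c == a) && (d == b))) => H1.
    rewrite (_ : (c == b) && (d == a) = false); last lia.
    by rewrite (_ : (minn a b < c < maxn a b)%N && _ = false) ?addr0 //; lia.
  case: (boolP ((c == b) && (d == a))) => H2.
    by rewrite (_ : (minn a b < c < maxn a b)%N && _ = false) ?addr0 ?add0r //; lia.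
  by rewrite !add0r; case: ifP.
rewrite !(sum_delta _ _ _ (fun k l => x ^+ k * y ^+ l)) sum_middle.
(* The telescoping starts at a = min + 1 and ends at b = max, so that its exponent a + b - (k + 1)
   is i + j - k. *)
have tel : (minn i j < maxn i j)%N by lia.
have {tel} := geometric_interval x y tel.
rewrite /sgn; case: (ltngtP (i : nat) j) => lij; last by case/eqP: ij.
- rewrite ltr0_sgz; last lia. rewrite gtr0_sgz; last lia.
  rewrite (eq_big_nat _ _ (F2 := fun k => x ^+ k * y ^+ (i + j - k)));
    last by move=> k _; congr (_ * _ ^+ _); lia.
  move=> T; rewrite mulrDr [_ * (_ * \sum_(_ <= _ < _) _)]mulrCA T.
  rewrite -[q ^ -1]/(q^-1) -[eta ^ 1]/eta -[1%:~R]/1 !exprS /hatF.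
  by field; exact/andP.
- rewrite gtr0_sgz; last lia. rewrite ltr0_sgz; last lia.
  rewrite (eq_big_nat _ _ (F2 := fun k => x ^+ k * y ^+ (i + j - k)));
    last by move=> k _; congr (_ * _ ^+ _); lia.
  move=> T; rewrite mulrDr [_ * (_ * \sum_(_ <= _ < _) _)]mulrCA T.
  rewrite -[eta ^ -1]/(eta^-1) -[q ^ 1]/q -[(-1)%:~R]/(-1) !exprS /hatF.
  by field; exact/andP.
Qed.
End CG.

Lemma CG_supp (F : fieldType) (q eta : F) (i j k l : nat) :
  (i + j)%N != (k + l)%N -> CG q eta i j k l = 0.
Proof.
move=> H; rewrite /CG.
case: ifP => H1; first lia.
case: ifP => H2; first lia.
case: ifP => H3; first lia.
by case: ifP => H4 //; lia.
Qed.

(** Here w stands for e^(pi i (z_1 - z_2 - 2 (alpha lambda + beta))), so [hatF w] is the common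
    denominator of both [G] factors. As x = w^2 y, one has x - y = y w [hatF w], and dividing by x -
    y cancels this pole. *)
Lemma SU_kernel_identity (F : fieldType) (d K x y w q eta S X1 X2 : F) :
  w != 0 -> y != 0 -> q != 0 -> eta != 0 ->
  hatF w != 0 -> hatF q != 0 -> hatF eta != 0 -> x = w ^+ 2 * y ->
  (x - y) * S = hatF q * (x * eta - y / eta) * X1
              - hatF eta * (x * q - y / q) * X2 ->
  d * hatF (w * eta) / (hatF w * hatF eta) * (K * X1)
    - d * hatF (w * q) / (hatF w * hatF q) * (K * X2)
  = d / (hatF eta * hatF q) * (K * S).
Proof.
move=> w0 y0 q0 eta0 hw hq he -> HS.
have xyE : w ^+ 2 * y - y = y * w * hatF w by rewrite /hatF; field.
have -> : S = (y * w * hatF w)^-1 * (hatF q * (w ^+ 2 * y * eta - y / eta) * X1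
              - hatF eta * (w ^+ 2 * y * q - y / q) * X2).
  by rewrite -HS xyE mulKf // !mulf_neq0.
have -> : hatF (w * eta) = (w ^+ 2 * eta - eta^-1) / w by rewrite /hatF; field; rewrite w0.
have -> : hatF (w * q) = (w ^+ 2 * q - q^-1) / w by rewrite /hatF; field; rewrite w0.
move: (hatF w) (hatF q) (hatF eta) hw hq he => a b c a0 b0 c0 {HS xyE}.
field; rewrite ?w0 ?y0 ?q0 ?eta0 ?a0 ?b0 ?c0 //.
Qed.

(** * Uniqueness of the restriction *)

Lemma sum_powers_eq0 (F : idomainType) (n : nat) (b : 'I_n -> F) (f : nat -> F) :
  injective f -> (forall r, \sum_(k < n) b k * f r ^+ k = 0) -> forall k, b k = 0.
Proof.
move=> f_inj bf0 k.
pose p := \poly_(i < n) (if insub i is Some i' then b i' else 0).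
have pE (i : 'I_n) : p`_i = b i by rewrite coef_poly ltn_ord valK.
have p_f r : p.[f r] = 0.
  rewrite horner_poly -[RHS](bf0 r); apply: eq_bigr => i _.
  by rewrite valK.
have [p0|pn0] := eqVneq p 0; first by rewrite -pE p0 coef0.
(* The first n values of [f] would be n distinct roots of a nonzero polynomial of degree less than
   n. *)
have := @max_poly_roots _ p (map f (iota 0 n)) pn0.
rewrite size_map size_iota map_inj_uniq ?iota_uniq // => H.
have : (size p <= n)%N by apply: size_poly.
suff : (n < size p)%N by lia.
by apply: H => //; apply/allP => _ /mapP[r _ ->]; apply/rootP.
Qed.

Section Restriction.
Variable R : realType.
Local Notation C := R[i].

(** Splitting off a factor independent of k turns tensors into polynomials in e^(2 pi i z_1) and
    e^(2 pi i z_2). *)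
Lemma phiE n k (z : C) :
  phi n k z = cexppi (- ((n%:R - 1) * z)) * cexppi z ^+ (2 * k).
Proof.
by rewrite -cexppiMn -cexppiD /phi /cexppi natrM; congr cexp; field.
Qed.

Lemma cexp_real (x : R) : cexp x%:C = (expR x)%:C.
Proof. by rewrite /cexp /= cos0 sin0 mulr1. Qed.

Lemma cexppi_imag (x : R) : cexppi (- ('i * x%:C)) = (expR (pi * x))%:C.
Proof.
rewrite -cexp_real /cexppi rmorphM -/(cpi R); congr cexp.
transitivity (- ('i ^+ 2) * (cpi R * x%:C)); first ring.
by rewrite sqrCi opprK mul1r.
Qed.

Lemma tensor_funE n (v : 'M[C]_n) z1 z2 :
  tensor_fun v z1 z2 =
  cexppi (- ((n%:R - 1) * z1)) * cexppi (- ((n%:R - 1) * z2)) *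
  \sum_(k < n) (\sum_(l < n) v k l * (cexppi z2 ^+ 2) ^+ l) * (cexppi z1 ^+ 2) ^+ k.
Proof.
rewrite /tensor_fun big_distrr; apply: eq_bigr => k _ /=.
rewrite big_distrl big_distrr; apply: eq_bigr => l _ /=.
rewrite !phiE !exprM; ring.
Qed.

Lemma tensor_fun_inj n (alpha beta lambda : C) (u v : 'M[C]_n) :
  mero_eq alpha beta lambda (tensor_fun u) (tensor_fun v) -> u = v.
Proof.
move=> uv; apply/eqP; rewrite -subr_eq0; apply/eqP.
set s := 2 * (alpha * lambda + beta) in uv.
(* The shift by -i (r + 1) multiplies e^(2 pi i z) by e^(2 pi (r + 1)), giving pairwise distinct
   values. Starting at 1 keeps z_1 - z_2 - s a nonzero imaginary number, hence off the polar
   divisor. *)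
pose t z (r : nat) : C := z - 'i * (r.+1%:R : R)%:C.
have tsq z r : cexppi (t z r) ^+ 2 = cexppi z ^+ 2 * (expR (pi * r.+1%:R) ^+ 2)%:C.
  by rewrite /t cexppiD cexppi_imag exprMn rmorphXn.
have tinj z : injective (fun r => cexppi (t z r) ^+ 2).
  move=> r r'; rewrite [LHS]tsq [RHS]tsq => H.
  have {H} := mulfI (expf_neq0 2 (cexppi_neq0 z)) H; case=> H.
  have {}H := pexpIrn (isT : (0 < 2)%N) (expR_ge0 _) (expR_ge0 _) H.
  have {}H := expR_inj H; have {H} := mulfI (lt0r_neq0 (pi_gt0 R)) H.
  by move/eqP; rewrite eqr_nat eqSS => /eqP.
have th z2 r : theta (t (z2 + s) r - z2 - s) != 0.
  rewrite theta_neq0 (_ : _ - s = - ('i * (r.+1%:R : R)%:C)); last by rewrite /t; ring.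
  rewrite cexppi_imag /hat -fmorphV -rmorphB fmorph_eq0 -expRN subr_eq0.
  apply/eqP => /expR_inj H; have := mulr_gt0 (pi_gt0 R) (ltr0Sn R r); lra.
apply/matrixP => k l; rewrite [RHS]mxE; move: l.
(* First z_2 runs through [t 0 r] to separate the powers l; then, for each such z_2, z_1 runs
   through shifts of z_2 + s to separate the powers k. *)
apply: (@sum_powers_eq0 _ _ (fun l => (u - v) k l) _ (tinj 0)) => r.
move: k; apply: (@sum_powers_eq0 _ _ _ _ (tinj (t 0 r + s))) => r'.
have := uv _ _ (th (t 0 r) r'); rewrite !tensor_funE => /mulfI.
rewrite mulf_neq0 ?cexppi_neq0 // => /(_ isT) H.
move/eqP: H; rewrite -subr_eq0 -sumrB => /eqP H; rewrite -[RHS]H.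
apply: eq_bigr => k _; rewrite -mulrBl -sumrB; congr (_ * _).
by apply: eq_bigr => l _; rewrite !mxE mulrBl.
Qed.

Lemma coefs_act_delta n (X : coefs R n) (i j k l : 'I_n) :
  coefs_act X (delta_mx i j) k l = X i j k l.
Proof.
rewrite mxE (bigD1 i) //= [X in _ + X]big1 ?addr0 => [|a /negPf ai]; last first.
  by apply: big1 => b _; rewrite mxE ai mul0r.
rewrite (bigD1 j) //= [X in _ + X]big1 ?addr0 => [|b /negPf bj]; last first.
  by rewrite mxE bj andbF mul0r.
by rewrite mxE !eqxx mul1r.
Qed.

Lemma is_restriction_unique n (kappa alpha beta lambda : C) (X Y : coefs R n) :
  is_restriction kappa alpha beta lambda X ->
  is_restriction kappa alpha beta lambda Y -> X = Y.
Proof.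
move=> HX HY; apply/funext => i; apply/funext => j.
apply/funext => k; apply/funext => l.
rewrite -!coefs_act_delta.
suff -> : coefs_act X (delta_mx i j) = coefs_act Y (delta_mx i j) by [].
by apply: (@tensor_fun_inj _ alpha beta lambda) => z1 z2 z; rewrite -HX // -HY.
Qed.

(** * Computation of the restriction on basis tensors *)

Lemma is_restriction_basis n (kappa alpha beta lambda : C) (X : coefs R n) :
  (forall i j : 'I_n, mero_eq alpha beta lambda
     (SU kappa alpha beta lambda (fun z1 z2 => phi n i z1 * phi n j z2))
     (fun z1 z2 => \sum_(k < n) \sum_(l < n) X i j k l * (phi n k z1 * phi n l z2))) ->
  is_restriction kappa alpha beta lambda X.
Proof.
move=> H v z1 z2 z12.
transitivity (\sum_(i < n) \sum_(j < n) v i j *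
    SU kappa alpha beta lambda (fun z1 z2 => phi n i z1 * phi n j z2) z1 z2).
  rewrite /SU /tensor_fun !big_distrr -sumrB; apply: eq_bigr => i _ /=.
  by rewrite !big_distrr -sumrB; apply: eq_bigr => j _ /=; ring.
rewrite /tensor_fun !pair_bigA /=.
transitivity (\sum_(kl : 'I_n * 'I_n) \sum_(ij : 'I_n * 'I_n)
   v ij.1 ij.2 * X ij.1 ij.2 kl.1 kl.2 * (phi n kl.1 z1 * phi n kl.2 z2)).
  rewrite exchange_big; apply: eq_bigr => [[i j] _] /=.
  rewrite H // pair_bigA big_distrr; apply: eq_bigr => [[k l] _] /=.
  by rewrite mulrA.
apply: eq_bigr => [[k l] _] /=.
by rewrite mxE pair_bigA big_distrl.
Qed.

(** On the support l = i + j - k, so l can be eliminated from the twist. What remains involves p and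
    beta only through p e^(2 pi i beta), which is why the powers of p amount to a shift of beta. *)
Lemma RCGabE n (p q alpha beta lambda g : C) (i j k l : 'I_n) :
  p != 0 -> p * cexppi (2 * beta) = g ->
  let Z := cexppi (2 * alpha * lambda) in
  RCGab p q alpha beta lambda i j k l =
  Z ^+ (2 * i) * g ^+ (2 * j) / (Z * g) ^+ (2 * k) * CG q (cexppi lambda) i j k l.
Proof.
move=> p0 <- Z; set b := cexppi (2 * beta).
rewrite /RCGab /RCG -/(cexppi lambda) -/(CG q (cexppi lambda) i j k l).
have [ijkl|/CG_supp ->] := eqVneq (i + j)%N (k + l)%N; last by rewrite !(mulr0, mul0r).
have Z0 : Z != 0 := cexppi_neq0 _.
have b0 : b != 0 := cexppi_neq0 _.
have BE mu m : Beig mu m = cexppi (2 * mu) ^+ m :> C.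
  by rewrite -cexppiMn /Beig /cexppi; congr cexp; ring.
have B1 m : Beig (alpha * lambda - beta) m = (Z / b) ^+ m.
  by rewrite BE mulrBr cexppiD cexppiN !mulrA.
have B2 m : Beig (alpha * - lambda - beta) m = (Z * b)^-1 ^+ m.
  rewrite BE (_ : 2 * _ = - (2 * alpha * lambda) - 2 * beta); last by ring.
  by rewrite cexppiD !cexppiN [(Z * b)^-1]invfM.
have pw (x : C) : x != 0 -> x ^+ l = x ^+ i * x ^+ j / x ^+ k.
  by move=> x0; rewrite -exprD ijkl exprD mulrAC divff ?mul1r // expf_neq0.
rewrite (_ : p ^ _ = p ^+ (2 * j) / p ^+ (2 * k)); last first.
  by rewrite mulrBr -!PoszM expfzDr // -exprnN.
have sq (u : C) m : u ^+ (2 * m) = u ^+ m ^+ 2 by rewrite mulnC exprM.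
rewrite /Feig !B1 !B2; clearbody Z b.
rewrite !sq !exprMn !exprVn !exprMn !pw //.
field.
by rewrite !expf_neq0.
Qed.

(** Opposite shifts cancel in the prefactors. This serves both terms of [SU]: with a = 2 alpha
    lambda, and with a = 2 beta after exchanging the two factors. *)
Lemma phi_shift n i j (z1 z2 a : C) :
  phi n i (z2 + a) * phi n j (z1 - a) =
  cexppi (- ((n%:R - 1) * z1)) * cexppi (- ((n%:R - 1) * z2)) *
  ((cexppi z2 * cexppi a) ^+ (2 * i) * (cexppi z1 / cexppi a) ^+ (2 * j)).
Proof.
rewrite !phiE !cexppiD !cexppiN !mulrDr !cexppiD mulrN cexppiN.
have := cexppi_neq0 ((n%:R - 1) * a).
move: (cexppi (_ * a)) (cexppi (_ * z1)) (cexppi (_ * z2)) => u u1 u2 u0.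
by rewrite !invfM invrK; move: (_ ^+ _) (_ ^+ _) (u1^-1) (u2^-1) => P Q v1 v2; field.
Qed.

Lemma SU_restriction n (kappa alpha beta beta' lambda p : C) :
  ~ is_integer kappa -> ~ is_integer lambda ->
  p != 0 -> p * cexppi (2 * beta') = cexppi (2 * beta) ->
  let q := cexppi kappa in
  is_restriction kappa alpha beta lambda
    (fun i j k l : 'I_n =>
       cpi R * (2 * 'i) / (hat (cexppi lambda) * hat q) *
       RCGab p q alpha beta' lambda i j k l).
Proof.
move=> kZ lZ p0 pb q; apply: is_restriction_basis => i j z1 z2.
set s := 2 * _ => th.
have := th; rewrite theta_neq0.
set w := cexppi _ => hw.
set U := cexppi z1; set V := cexppi z2; set Z := cexppi (2 * alpha * lambda).
set g := cexppi (2 * beta) in pb.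
have U0 : U != 0 := cexppi_neq0 _.
have V0 : V != 0 := cexppi_neq0 _.
have Z0 : Z != 0 := cexppi_neq0 _.
have g0 : g != 0 := cexppi_neq0 _.
have wE : w = U / (V * (Z * g)).
  by rewrite /w /s !cexppiD !cexppiN mulrDr cexppiD !mulrA !invfM !mulrA.
pose x := (U / (Z * g)) ^+ 2; pose y := V ^+ 2.
pose M := cexppi (- ((n%:R - 1) * z1)) * cexppi (- ((n%:R - 1) * z2)).
(* With this factor both shifted tensors become monomials, K x^j y^i and K x^i y^j. *)
pose K := M * (Z ^+ (2 * i) * g ^+ (2 * j)).
have xw : x = w ^+ 2 * y by rewrite /x /y wE; field; rewrite Z0 g0 V0.
have eta0 : cexppi lambda != 0 := cexppi_neq0 _.
have q0 : q != 0 := cexppi_neq0 _.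
have ci := neq0Ci C.
(* [G] has one theta above and two below, so one factor 2 i survives next to theta'(0) = pi. *)
have GE c : ~ is_integer c -> G (z1 - z2 - s) c =
    cpi R * (2 * 'i) * hat (w * cexppi c) / (hat w * hat (cexppi c)).
  move=> /hat_cexppi_neq0 hc; rewrite /G derive1_theta0 !thetaE cexppiD -/w.
  by move: (hat _) (hat w) (hat _) hc hw => h1 h2 h3 h10 h20; field; rewrite ci h10 h20.
pose f := fun u1 u2 : C => phi n i u1 * phi n j u2.
have sq (u : C) m : u ^+ (2 * m) = u ^+ m ^+ 2 by rewrite mulnC exprM.
have F1 : f (z2 + 2 * alpha * lambda) (z1 - 2 * alpha * lambda)
  = K * (x ^+ j * y ^+ i).
  rewrite /f phi_shift -/M -/U -/V -/Z /K /x /y -!exprM !sq.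
  move: M Z U V g Z0 U0 V0 g0 {K x y wE xw pb} => M Z U V g Z0 U0 V0 g0.
  by rewrite !exprMn !exprVn !exprMn; field; rewrite !expf_neq0.
have F2 : f (z1 - 2 * beta) (z2 + 2 * beta) = K * (x ^+ i * y ^+ j).
  rewrite /f mulrC phi_shift -/M -/U -/V -/g /K /x /y -!exprM !sq.
  move: M Z U V g Z0 U0 V0 g0 {K x y wE xw pb F1} => M Z U V g Z0 U0 V0 g0.
  by rewrite !exprMn !exprVn !exprMn; field; rewrite !expf_neq0.
rewrite -[LHS]/(
  G (z1 - z2 - s) lambda * f (z2 + 2 * alpha * lambda) (z1 - 2 * alpha * lambda)
  - G (z1 - z2 - s) kappa * f (z1 - 2 * beta) (z2 + 2 * beta)).
rewrite (GE _ lZ) (GE _ kZ) F1 F2.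
have y0 : y != 0 by rewrite expf_neq0.
have E1 := SU_kernel_identity (cpi R * (2 * 'i)) K (cexppi_neq0 _ : w != 0) y0 q0 eta0
  hw (hat_cexppi_neq0 kZ) (hat_cexppi_neq0 lZ) xw (CG_sum x y q0 eta0 i j).
rewrite [LHS]E1.
rewrite !big_distrr; apply: eq_bigr => k _ /=.
rewrite !big_distrr; apply: eq_bigr => l _ /=.
(* The factor (Z g)^(-2k) hidden in x^k, together with Z^(2i) g^(2j) from K, is exactly the twist in
   [RCGabE]. *)
rewrite (RCGabE _ _ _ _ _ _ _ p0 pb) -/Z !phiE -/U -/V -[RHS]mulrA; congr (_ * _).
rewrite /K /M /x /y -!exprM !sq.
move: (CG _ _ _ _ _ _) => c.
move: (cexppi (- (_ * z1))) (cexppi (- (_ * z2))) => m1 m2.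
move: Z U V g Z0 U0 V0 g0 {K M x y wE xw pb F1 F2 y0 E1} => Z U V g Z0 U0 V0 g0.
by rewrite !exprMn !exprVn !exprMn; field; rewrite !expf_neq0.
Qed.
End Restriction.

(** * Matching the two families of parameters *)

Lemma restriction_is_RCG_shift (R : realType) n (kappa alpha beta beta' : R[i]) :
  (0 < n)%N -> ~ is_integer kappa -> 2 * beta = kappa / n%:R + 2 * beta' ->
  restriction_is_RCG n kappa alpha beta alpha beta'.
Proof.
move=> n0 kZ bb.
exists (fun lambda =>
  cpi R * (2 * 'i) / (hat (cexppi lambda) * hat (cexppi kappa))) => lambda lZ.
split.
  rewrite !mulf_neq0 ?invr_eq0 ?mulf_neq0 ?hat_cexppi_neq0 ?pnatr_eq0 ?neq0Ci //.
  by have := cpi2i_neq0 R; rewrite mulf_eq0 negb_or => /andP[].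
rewrite -[cpi R * 'i * kappa / n%:R]mulrA.
apply: SU_restriction => //; first exact: cexppi_neq0.
by rewrite bb cexppiD.
Qed.

Theorem theorem4p4 (R : realType) (n : nat) (kappa : R[i]) :
  (1 <= n)%N -> ~ is_integer kappa ->
  (forall alpha beta lambda : R[i], ~ is_integer lambda ->
     exists X : coefs R n,
       unique (is_restriction kappa alpha beta lambda) X /\ homogeneous X) /\
  (forall alpha beta : R[i], exists alpha' beta' : R[i],
     restriction_is_RCG n kappa alpha beta alpha' beta') /\
  (forall alpha' beta' : R[i], exists alpha beta : R[i],
     restriction_is_RCG n kappa alpha beta alpha' beta').
Proof.
move=> n0 kZ.
have H alpha beta :
    restriction_is_RCG n kappa alpha beta alpha (beta - kappa / n%:R / 2).
  apply: restriction_is_RCG_shift => //; field; rewrite pnatr_eq0; lia.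
split=> [alpha beta lambda lZ|].
  have [c /(_ lambda lZ)[_ HX]] := H alpha beta.
  exists (fun i j k l => c lambda *
    RCGab (cexp (cpi R * 'i * kappa / n%:R)) (cexp (cpi R * 'i * kappa))
      alpha (beta - kappa / n%:R / 2) lambda i j k l).
  split=> [|i j k l /eqP ijkl]; first by split=> // Y; exact: is_restriction_unique.
  by rewrite (RCGabE _ _ _ _ _ _ _ (cexp_neq0 _) erefl) CG_supp ?mulr0.
split=> alpha beta; first by exists alpha, (beta - kappa / n%:R / 2).
(* The shift of beta by kappa / (2 n) is invertible, so every pair of parameters is reached. *)
exists alpha, (beta + kappa / n%:R / 2).
by rewrite -{2}[beta](addrK (kappa / n%:R / 2)).
Qed.
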